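(* Consider an instance of fair $k$-center: a finite metric space $(X,d)$, a group assignment $g:X\to\{1,\dots,m\}$, capacities $k_1,\dots,k_m$ with $k=\sum_jk_j$, and $\mathrm{OPT}$ the minimum clustering cost for $X$ of a feasible set; let $\tau\ge\mathrm{OPT}$. Let $X$ be partitioned among $\ell$ processors into $X_1,\dots,X_\ell$, each of size at least $k+1$. Each processor $i$ computes: $p^i_1\in X_i$ arbitrary; for $j=2,\dots,k+1$, $p^i_j\in\arg\max_{p\in X_i}\min_{1\le j'<j}d(p,p^i_{j'})$; $P_i=\{p^i_1,\dots,p^i_k\}$; $r_i=\min_{1\le j'\le k}d(p^i_{k+1},p^i_{j'})/2$; for each $p\in P_i$, a set $L(p)$ obtained by initializing $L(p)=\{p\}$ and scanning $X_i$ in an arbitrary order, adding a scanned $x$ whenever $d(p,x)\le2r_i$ and $L(p)$ has no point of group $g(x)$ yet; and $L_i=\bigcup_{p\in P_i}L(p)$; it sends $(P_i,L_i)$ to a coordinator. The coordinator sets $X'=\bigcup_iP_i$, $L=\bigcup_iL_i$, and: (1) computes $P\subseteq X'$ by scanning $X'$ in an arbitrary order, starting with $P$ containing the first point and adding a scanned $q$ whenever $\min_{p\in P}d(p,q)>10\tau$; (2) for each $q\in P$, initializes $N(q)=\{q\}$ and scans $L$ in an arbitrary order, adding a scanned $x$ to $N(q)$ whenever $d(q,x)\le5\tau$ and $N(q)$ has no point of group $g(x)$ yet; (3) outputs a feasible set $S\subseteq\bigcup_{q\in P}N(q)$ intersecting the maximum possible number of the sets $N(q)$, $q\in P$, among all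 feasible subsets of $\bigcup_{q\in P}N(q)$. Then $S$ is feasible and its clustering cost for $X$ is at most $17\tau$. In particular, if $\tau\in[\mathrm{OPT},(1+\varepsilon)\mathrm{OPT}]$ then $S$ is a $17(1+\varepsilon)$-approximation.
   Context: For nonempty $A,B\subseteq X$, the clustering cost of $A$ for $B$ is $\max_{b\in B}\min_{a\in A}d(a,b)$. A set $S\subseteq X$ is feasible if for every group $j$ it contains at most $k_j$ points of group $j$. The fair $k$-center problem asks for a feasible set of minimum clustering cost for $X$, whose value is $\mathrm{OPT}$. Each processor can only compute distances between its own points; the coordinator can compute distances among the points it receives. *)

(* Defs.v *)
From HB Require Import structures.
From mathcomp Require Import all_boot all_order all_algebra.
From mathcomp Require Import filter reals constructive_ereal.
From mathcomp Require Import topology_structure uniform_structure.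
From mathcomp Require Import pseudometric_structure metric_structure.

Set Implicit Arguments.
Unset Strict Implicit.
Unset Printing Implicit Defensive.

Import Order.TTheory GRing.Theory Num.Theory.

Local Open Scope ring_scope.

#[short(type="finMetricType")]
HB.structure Definition FinMetric (R : numDomainType) :=
  {T of Finite T & Metric R T}.

(* min_{a in A} d(a, x), with value +oo when A is empty. *)
Definition dist_to (R : realType) (X : finMetricType R) (A : {set X}) (x : X) :
    \bar R :=
  \big[mine/+oo%E]_(a in A) (mdist a x)%:E.

(* Real-valued for nonempty A and B; when B is nonempty, the empty set has cost
   +oo and so is never a solution of finite cost. *)
Definition clustering_cost (R : realType) (X : finMetricType R)
    (A B : {set X}) : \bar R :=
  \big[maxe/-oo%E]_(b in B) dist_to A b.

Definition feasible (X : finType) (m : nat) (g : X -> 'I_m) (cap : 'I_m -> nat)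
    (S : {set X}) : bool :=
  [forall j, #|[set x in S | g x == j]| <= cap j]%N.

Definition OPT (R : realType) (X : finMetricType R) (m : nat) (g : X -> 'I_m)
    (cap : 'I_m -> nat) : \bar R :=
  \big[mine/+oo%E]_(S : {set X} | feasible g cap S) clustering_cost S [set: X].

Definition is_approximation (R : realType) (X : finMetricType R) (m : nat)
    (g : X -> 'I_m) (cap : 'I_m -> nat) (c : R) (S : {set X}) : Prop :=
  feasible g cap S /\ (clustering_cost S [set: X] <= c%:E * OPT g cap)%E.

Definition scan_order (X : finType) (A : {set X}) (s : seq X) : bool :=
  perm_eq s (enum A).

(* Farthest-first traversal p_1, ..., p_{k+1} of Y, indexed from 0. *)
Definition farthest_first (R : realType) (X : finMetricType R) (Y : {set X})
    (k : nat) (p : 'I_k.+1 -> X) : Prop :=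
  (forall j, p j \in Y) /\
  (forall j : 'I_k.+1, (0 < j)%N -> forall x, x \in Y ->
     let previous := [set p j' | j' : 'I_k.+1 & (j' < j)%N] in
     (dist_to previous x <= dist_to previous (p j))%E).

Definition pivots (X : finType) (k : nat) (p : 'I_k.+1 -> X) : {set X} :=
  [set p j | j : 'I_k.+1 & (j < k)%N].

(* The minimum is finite for k > 0, the only case in which nonempty feasible
   sets can exist. *)
Definition pivot_radius (R : realType) (X : finMetricType R) (k : nat)
    (p : 'I_k.+1 -> X) : R :=
  fine (dist_to (pivots p) (p ord_max)) / 2.

(* Both L(p) and N(q): the scan of s from the center q, keeping at most one
   point of each group among those within distance rho of q. *)
Definition group_scan (R : realType) (X : finMetricType R) (m : nat)
    (g : X -> 'I_m) (q : X) (rho : R) (s : seq X) : {set X} :=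
  foldl (fun (N : {set X}) x =>
           if (mdist q x <= rho) && [forall y in N, g y != g x]
           then x |: N else N)
        [set q] s.

Definition separated_scan (R : realType) (X : finMetricType R) (rho : R)
    (s : seq X) : {set X} :=
  if s is x :: s' then
    foldl (fun (P : {set X}) q =>
             if (rho%:E < dist_to P q)%E then q |: P else P)
          [set x] s'
  else set0.

Definition hits (X : finType) (P : {set X}) (N : X -> {set X}) (S : {set X}) :
    nat :=
  #|[set q in P | S :&: N q != set0]|.

Definition max_hitting (X : finType) (m : nat) (g : X -> 'I_m)
    (cap : 'I_m -> nat) (P : {set X}) (N : X -> {set X}) (S : {set X}) : Prop :=
  let U := \bigcup_(q in P) N q in
  [/\ S \subset U, feasible g cap S &
      forall S' : {set X}, S' \subset U -> feasible g cap S' ->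
        (hits P N S' <= hits P N S)%N].

(* Main.v *)
(** Fix a feasible set [O] of cost at most [tau]; it has at most [k] points. By
    pigeonhole two of the [k + 1] points of a farthest-first traversal share a
    center in [O]; as the traversal is [2 r_i]-separated, this gives
    [r_i <= tau], so the pivots of processor [i] are [2 tau]-dense in
    [X_i]. For [q] in [P], let [o] be a point of [O] within [tau] of [q]. Some
    pivot is within [2 tau] of [o], and its list contains a point of the group
    of [o] within [2 tau] of the pivot, hence within [5 tau] of [q]. So [N q]
    meets the group of [o]. Since [P] is [10 tau]-separated, distinct [q] have
    distinct [o], and picking in each [N q] a point of the group of [o] yields a
    feasible set hitting every [N q]. The maximal [S] must then hit every [N q]
    too, and the total distance is at most [2 tau + 10 tau + 5 tau]. *)

Require Import Defs.
From HB Require Import structures.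
From mathcomp Require Import all_boot all_order all_algebra.
From mathcomp Require Import reals constructive_ereal metric_structure.
From mathcomp Require Import boolp lra.

Import Order.TTheory GRing.Theory Num.Theory.

Local Open Scope ring_scope.

(** * Extended-real minima and maxima turned into statements about points *)

Section Distances.
Context {R : realType} {X : finMetricType R}.
Implicit Types (A B Y : {set X}) (x : X) (r : R).

Lemma dist_to_leP A x r :
  reflect (exists2 a, a \in A & mdist a x <= r) (dist_to A x <= r%:E)%E.
Proof.
apply: (iffP (bigmin_leP _ _ _ _)) => [[//|[a aA]]|[a aA ax]].
  by rewrite lee_fin; exists a.
by right; exists a.
Qed.

Lemma dist_to_gtP A x r :
  reflect (forall a, a \in A -> r < mdist a x) (r%:E < dist_to A x)%E.
Proof.
apply: (iffP (bigmin_gtP _ _ _ _)) => [[_ h] a /h|h]; first by rewrite lte_fin.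
by split=> [|a /h]; rewrite ?ltry ?lte_fin.
Qed.

Lemma dist_to_le A a x : a \in A -> (dist_to A x <= (mdist a x)%:E)%E.
Proof. by move=> aA; apply/dist_to_leP; exists a. Qed.

Lemma dist_toS A B x : A \subset B -> (dist_to B x <= dist_to A x)%E.
Proof. by move=> /subsetP AB; apply: sub_bigmin => a /AB. Qed.

Lemma dist_to_fin_num A a x : a \in A -> dist_to A x \is a fin_num.
Proof.
move=> aA; rewrite ge0_fin_numE.
  exact: le_lt_trans (dist_to_le _ _ x aA) (ltry _).
by apply/bigmin_geP; split=> [|b _]; rewrite ?leey ?lee_fin ?mdist_ge0.
Qed.

Lemma clustering_cost_leP A B r :
  reflect (forall b, b \in B -> exists2 a, a \in A & mdist a b <= r)
          (clustering_cost A B <= r%:E)%E.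
Proof.
apply: (iffP (bigmax_leP _ _ _ _)) => [[_ h] b /h /dist_to_leP //|h].
by split=> [|b /h /dist_to_leP]; rewrite ?leNye.
Qed.

End Distances.

(** * Density and separation of a greedy traversal *)

Section FarthestFirst.
Context {R : realType} {X : finMetricType R} {k : nat}.
Context {Y : {set X}} {p : 'I_k.+1 -> X}.
Hypotheses (k_gt0 : (0 < k)%N) (p_greedy : farthest_first Y p).

Lemma pivot_radiusE :
  (2 * pivot_radius p)%:E = dist_to (pivots p) (p ord_max).
Proof.
(* As [k] is positive, [p ord0] is a pivot, so the minimum is finite and [fine] loses nothing. *)
have pp : p ord0 \in pivots p by apply/imsetP; exists ord0; rewrite ?inE.
rewrite /pivot_radius mulrC divfK ?pnatr_eq0// fineK//.
exact: dist_to_fin_num pp.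
Qed.

Lemma farthest_first_cover x :
  x \in Y -> exists2 q, q \in pivots p & mdist q x <= 2 * pivot_radius p.
Proof.
move=> xY; apply/dist_to_leP; rewrite pivot_radiusE.
exact: (p_greedy.2 ord_max k_gt0 x xY).
Qed.

(** The last point was also a candidate when [p j] was chosen. So its distance to the points
    preceding [p j], which is at least its distance to all pivots, is at most that of [p j]; and
    [p i] is one of these points. *)
Lemma farthest_first_separated (i j : 'I_k.+1) :
  (i < j)%N -> 2 * pivot_radius p <= mdist (p i) (p j).
Proof.
move=> ij; rewrite -lee_fin pivot_radiusE.
set prev := [set p j' | j' : 'I_k.+1 & (j' < j)%N].
have prev_sub : prev \subset pivots p.
  apply/subsetP => _ /imsetP[j' + ->]; rewrite inE => j'j.
  by apply/imsetP; exists j'; rewrite ?inE// (leq_trans j'j)// -ltnS ltn_ord.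
apply: le_trans (dist_toS _ _ _ prev_sub) _.
apply: (@le_trans _ _ (dist_to prev (p j))).
  by apply: p_greedy.2; [exact: leq_ltn_trans ij | exact: p_greedy.1].
by apply: dist_to_le; apply/imsetP; exists i; rewrite ?inE.
Qed.

Lemma pivot_radius_le (C : {set X}) (tau : R) :
  (#|C| <= k)%N ->
  (forall x, x \in Y -> exists2 a, a \in C & mdist a x <= tau) ->
  pivot_radius p <= tau.
Proof.
move=> C_small C_cover.
have /choice[c c_spec] : forall j, exists a, a \in C /\ mdist a (p j) <= tau.
  move=> j; have [a aC ap] := C_cover _ (p_greedy.1 j).
  by exists a.
have /injectivePn[i [j ij cij]] : ~~ injectiveb c.
  apply/negP => /injectiveP c_inj.
  suff : (k.+1 <= #|C|)%N by rewrite leqNgt ltnS C_small.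
  rewrite -(card_ord k.+1) -(card_codom c_inj); apply: subset_leq_card.
  by apply/subsetP => _ /codomP[j ->]; case: (c_spec j).
wlog lt_ij : i j ij cij / (i < j)%N.
  case: (ltngtP i j) => [||/val_inj/eqP]; rewrite ?(negPf ij)//; first by eauto.
  by rewrite eq_sym in ij; eauto.
have := farthest_first_separated _ _ lt_ij.
have := metric_triangle (p i) (c i) (p j).
have [_ ci] := c_spec i; have [_] := c_spec j; rewrite -cij => cj.
by rewrite (metric_sym (p i) (c i)); lra.
Qed.

End FarthestFirst.

(** * Invariants of the greedy scans *)

Section Scans.
Context {R : realType} {X : finMetricType R}.
Implicit Types (q x y : X) (rho : R) (s : seq X).

Lemma group_scan_dist m (g : X -> 'I_m) q rho s y :
  0 <= rho -> y \in group_scan g q rho s -> mdist q y <= rho.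
Proof.
move=> rho0; rewrite /group_scan.
have : forall z, z \in [set q] -> mdist q z <= rho.
  by move=> z /set1P ->; rewrite mdistxx.
elim: s [set q] => [|x s IH] A A_near /=; first exact: A_near.
apply: IH => z; case: ifP => [/andP[qx _]|_]; last exact: A_near.
by case/setU1P => [->//|]; exact: A_near.
Qed.

(** When [x] is scanned, either it is added or its group is already represented; [step_keep] says
    that later steps remove nothing. *)
Lemma group_scan_group m (g : X -> 'I_m) q rho s x :
  x \in s -> mdist q x <= rho ->
  exists2 y, y \in group_scan g q rho s & g y = g x.
Proof.
move=> xs qx; rewrite /group_scan.
set step := (F in foldl F).
have step_keep : forall t (A : {set X}) j, (exists2 y, y \in A & g y = j) ->
    exists2 y, y \in foldl step A t & g y = j.
  elim=> [//|z t IH] A j [y yA gy] /=; apply: IH; exists y => //.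
  by rewrite /step; case: ifP => // _; rewrite inE yA orbT.
elim: s [set q] xs => [//|z s IH] A.
rewrite inE => /predU1P[<-|xs] /=; last exact: IH.
apply: step_keep; rewrite /step qx /=.
case: ifPn => [_|]; first by exists x; rewrite ?setU11.
by rewrite negb_forall_in => /exists_inP[y yA /negPn/eqP]; exists y.
Qed.

(** A scanned point that is rejected has a kept point within [rho]; one that is added covers itself,
    as [rho] is nonnegative. *)
Lemma separated_scan_cover rho s x : 0 <= rho -> x \in s ->
  exists2 q, q \in separated_scan rho s & mdist q x <= rho.
Proof.
move=> rho0; case: s => [//|z s] /=.
set step := (F in foldl F).
have step_keep : forall t (A : {set X}),
    (exists2 q, q \in A & mdist q x <= rho) ->
    exists2 q, q \in foldl step A t & mdist q x <= rho.
  elim=> [//|y t IH] A [q qA qx] /=; apply: IH; exists q => //.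
  by rewrite /step; case: ifP => // _; rewrite inE qA orbT.
rewrite inE => /predU1P[xz|].
  by apply: step_keep; exists z; rewrite ?set11// xz mdistxx.
elim: s [set z] => [//|y s IH] A.
rewrite inE => /predU1P[<-|xs] /=; last exact: IH.
apply: step_keep; rewrite /step; case: ltP => [_|/dist_to_leP //].
by exists x; rewrite ?setU11 ?mdistxx.
Qed.

Lemma separated_scan_separated rho s :
  {in separated_scan rho s &, forall q q', q != q' -> rho < mdist q q'}.
Proof.
case: s => [|z s] /=; first by move=> q q'; rewrite inE.
have : {in [set z] &, forall q q', q != q' -> rho < mdist q q'}.
  by move=> q q' /set1P-> /set1P->; rewrite eqxx.
elim: s [set z] => [//|y s IH] A A_sep /=; apply: IH.
case: dist_to_gtP => // y_far q q' /setU1P[->|qA] /setU1P[->|q'A].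
- by rewrite eqxx.
- by rewrite metric_sym => _; exact: y_far.
- by move=> _; exact: y_far.
- exact: A_sep.
Qed.

End Scans.

(** * Group capacities and maximal hitting sets *)

Section Feasibility.
Context {X : finType} {m : nat} {g : X -> 'I_m} {cap : 'I_m -> nat}.

Lemma feasible_card (S : {set X}) :
  feasible g cap S -> (#|S| <= \sum_(j < m) cap j)%N.
Proof.
move=> /forallP S_feas; rewrite -sum1_card (partition_big g predT)//=.
by apply: leq_sum => j _; rewrite sum1dep_card.
Qed.

(* A system of representatives of the [N q] whose groups are those of distinct
   points of a feasible set is itself feasible. *)
Lemma max_hitting_all (P : {set X}) (N : X -> {set X}) (S C : {set X})
    (o : X -> X) :
  max_hitting g cap P N S -> feasible g cap C ->
  {in P, forall q, o q \in C} -> {in P &, injective o} ->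
  {in P, forall q, exists2 y, y \in N q & g y = g (o q)} ->
  {in P, forall q, exists2 y, y \in S & y \in N q}.
Proof.
move=> [_ _ S_best] /forallP C_feas oC o_inj N_group q qP.
have /choice[c c_spec] : forall q, exists y,
    q \in P -> y \in N q /\ g y = g (o q).
  (* Outside [P] the value is arbitrary; [q'] itself serves as a default. *)
  move=> q'; case: (boolP (q' \in P)) => [|_]; last by exists q'.
  by move=> /N_group[y yN gy]; exists y.
have c_feas : feasible g cap (c @: P).
  apply/forallP => j; apply: leq_trans (C_feas j).
  pose Pj := [set q' in P | g (o q') == j].
  have -> : [set x in c @: P | g x == j] = c @: Pj.
    apply/setP => x; rewrite inE; apply/andP/imsetP.
      move=> [/imsetP[q' q'P ->] gj]; exists q' => //.
      by rewrite inE q'P; have [_ <-] := c_spec _ q'P.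
    move=> [q' + ->]; rewrite inE => /andP[q'P gj].
    by rewrite imset_f//; have [_ ->] := c_spec _ q'P.
  (* [c] need not be injective: its image of [Pj] has at most as many points as [Pj], hence as
     [o @: Pj], which lies in the part of [C] of group [j]. *)
  apply: leq_trans (leq_imset_card _ _) _.
  have o_inj_j : {in Pj &, injective o}.
    by move=> x y; rewrite !inE => /andP[xP _] /andP[yP _]; exact: o_inj.
  rewrite -(card_in_imset o_inj_j); apply: subset_leq_card.
  apply/subsetP => _ /imsetP[q' + ->]; rewrite !inE => /andP[q'P ->].
  by rewrite oC.
have c_sub : c @: P \subset \bigcup_(q in P) N q.
  apply/subsetP => _ /imsetP[q' q'P ->]; apply/bigcupP; exists q' => //.
  by case: (c_spec _ q'P).
have hits_c : hits P N (c @: P) = #|P|.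
  congr #|pred_of_set _|; apply/setP => q'; rewrite inE.
  case: (boolP (q' \in P)) => //= q'P; apply/set0Pn; exists (c q').
  by rewrite inE imset_f//; case: (c_spec _ q'P).
(* By maximality [S] hits at least [#|P|] of the sets, hence all of them. *)
have := S_best _ c_sub c_feas; rewrite hits_c => P_le.
have /eqP hitP : [set q in P | S :&: N q != set0] == P.
  by rewrite eqEcard P_le andbT; apply/subsetP => q'; rewrite inE => /andP[].
move: qP; rewrite -{1}hitP inE => /andP[_ /set0Pn[y]].
by rewrite inE => /andP[yS yN]; exists y.
Qed.

End Feasibility.

(** The default [+oo] of the minimum is not below a real [tau], so the bound comes from an actual
    feasible set. *)
Lemma OPT_le_cover (R : realType) (X : finMetricType R) m (g : X -> 'I_m)
    (cap : 'I_m -> nat) (tau : R) :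
  (OPT g cap <= tau%:E)%E ->
  exists2 C : {set X}, feasible g cap C &
    forall x, exists2 a, a \in C & mdist a x <= tau.
Proof.
move=> /bigmin_leP[//|[C C_feas /clustering_cost_leP C_cover]].
by exists C => // x; apply: C_cover; rewrite inE.
Qed.

(** * Assembly of the distance bounds *)

Theorem theorem2
  (R : realType) (X : finMetricType R)
  (m : nat) (g : X -> 'I_m) (cap : 'I_m -> nat)
  (k : nat) (k_def : k = (\sum_(j < m) cap j)%N)
  (tau : R) (tau_ge_OPT : (OPT g cap <= tau%:E)%E)
  (* the partition among the processors *)
  (l : nat) (Xs : 'I_l -> {set X})
  (Xs_cover : \bigcup_(i < l) Xs i = [set: X])
  (Xs_disjoint : forall i i' : 'I_l, i != i' -> [disjoint Xs i & Xs i'])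
  (Xs_large : forall i : 'I_l, (k.+1 <= #|Xs i|)%N)
  (* the processors *)
  (p : 'I_l -> 'I_k.+1 -> X)
  (p_greedy : forall i : 'I_l, farthest_first (Xs i) (p i))
  (ordL : 'I_l -> X -> seq X)
  (ordL_scan : forall (i : 'I_l) (q : X), q \in pivots (p i) ->
     scan_order (Xs i) (ordL i q))
  (Ls : 'I_l -> {set X})
  (Ls_def : forall i : 'I_l,
     Ls i = \bigcup_(q in pivots (p i))
              group_scan g q (2 * pivot_radius (p i)) (ordL i q))
  (* the coordinator *)
  (X' : {set X}) (X'_def : X' = \bigcup_(i < l) pivots (p i))
  (L : {set X}) (L_def : L = \bigcup_(i < l) Ls i)
  (ordP : seq X) (ordP_scan : scan_order X' ordP)
  (P : {set X}) (P_def : P = separated_scan (10 * tau) ordP)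
  (ordN : X -> seq X)
  (ordN_scan : forall q : X, q \in P -> scan_order L (ordN q))
  (N : X -> {set X})
  (N_def : forall q : X, q \in P -> N q = group_scan g q (5 * tau) (ordN q))
  (S : {set X}) (S_max : max_hitting g cap P N S) :
  [/\ feasible g cap S,
      (clustering_cost S [set: X] <= (17 * tau)%:E)%E &
      forall eps : R, (tau%:E <= (1 + eps)%:E * OPT g cap)%E ->
        is_approximation g cap (17 * (1 + eps)) S].
Proof.
have S_feas : feasible g cap S by case: S_max.
suff S_cover : forall x, exists2 a, a \in S & mdist a x <= 17 * tau.
  have S_cost : (clustering_cost S [set: X] <= (17 * tau)%:E)%E.
    by apply/clustering_cost_leP => x _; exact: S_cover.
  split=> // eps tau_le; split=> //; apply: le_trans S_cost _.
  by rewrite !EFinM -muleA; apply: lee_wpmul2l; rewrite ?lee_fin.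
have [C C_feas C_cover] := OPT_le_cover _ _ _ _ _ _ tau_ge_OPT.
(* Having a point at hand makes [C] nonempty, which forces [tau] to be nonnegative and [k]
   positive. *)
move=> x0.
have tau_ge0 : 0 <= tau.
  by have [a _] := C_cover x0; exact: le_trans (mdist_ge0 _ _).
have C_small : (#|C| <= k)%N by rewrite k_def; exact: feasible_card C_feas.
have k_gt0 : (0 < k)%N.
  have [a aC _] := C_cover x0; apply: leq_trans C_small.
  by apply/card_gt0P; exists a.
have r_le i : pivot_radius (p i) <= tau.
  by apply: (pivot_radius_le k_gt0 (p_greedy i) C) => // x _; exact: C_cover.
have pivot_near x : exists i, exists2 q, q \in pivots (p i) &
    x \in Xs i /\ mdist q x <= 2 * pivot_radius (p i).
  have : x \in [set: X] by rewrite inE.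
  rewrite -Xs_cover => /bigcupP[i _ xi]; exists i.
  by have [q qp qx] := farthest_first_cover k_gt0 (p_greedy i) _ xi; exists q.
have /choice[o o_spec] : forall q, exists a, a \in C /\ mdist a q <= tau.
  by move=> q; have [a aC aq] := C_cover q; exists a.
have o_inj : {in P &, injective o}.
  move=> q q'; rewrite P_def => qP q'P oqq'; apply/eqP/negPn/negP => neq.
  (* A shared center would give [10 * tau < mdist q q' <= 2 * tau], impossible for nonnegative
     [tau]. *)
  have := separated_scan_separated _ _ _ _ qP q'P neq.
  have := metric_triangle q (o q) q'.
  have [_ oq] := o_spec q; have [_] := o_spec q'; rewrite -oqq' => oq'.
  by rewrite (metric_sym q (o q)); lra.
have N_group : {in P, forall q, exists2 y, y \in N q & g y = g (o q)}.
  move=> q qP; have [i [z zp [oi zo]]] := pivot_near (o q).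
  have [||y yL gy] :=
    group_scan_group _ g z (2 * pivot_radius (p i)) (ordL i z) (o q).
  - by rewrite (perm_mem (ordL_scan i z zp)) mem_enum.
  - exact: zo.
  have zy : mdist z y <= 2 * pivot_radius (p i).
    (* The radius is nonnegative because it bounds the distance from [z] to [o q]. *)
    apply: group_scan_dist yL; apply: le_trans zo; exact: mdist_ge0.
  have yLL : y \in L.
    rewrite L_def; apply/bigcupP; exists i => //.
    by rewrite Ls_def; apply/bigcupP; exists z.
  rewrite N_def// -gy; apply: group_scan_group.
    by rewrite (perm_mem (ordN_scan q qP)) mem_enum.
  (* Along [q], [o q], [z], [y] the distances are at most [tau], [2 * tau] and [2 * tau], whence the
     radius [5 * tau]. *)
  have := metric_triangle q (o q) y; have := metric_triangle (o q) z y.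
  have [_] := o_spec q; have := r_le i.
  by rewrite (metric_sym q (o q)) (metric_sym (o q) z); lra.
have S_hits := max_hitting_all P N S C o S_max C_feas
  (fun q _ => (o_spec q).1) o_inj N_group.
have [i [z zp [_ zx]]] := pivot_near x0.
have [||q qP qz] := separated_scan_cover (10 * tau) ordP z.
- by lra.
- by rewrite (perm_mem ordP_scan) mem_enum X'_def; apply/bigcupP; exists i.
rewrite -P_def in qP; have [y yS yN] := S_hits q qP.
exists y => //; rewrite N_def// in yN.
have {yN} qy : mdist q y <= 5 * tau by apply: group_scan_dist yN; lra.
(* The path [y], [q], [z], [x0] has legs of at most [5 * tau], [10 * tau] and [2 * tau]. *)
have := metric_triangle y q x0; have := metric_triangle q z x0; have := r_le i.
by rewrite (metric_sym y q); lra.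
Qed.
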